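(* Let $k\ge 2$ and $t\ge 4$ be integers. Let $H$ be a $3$-uniform hypergraph that admits a $k$-coloring of its edges with no monochromatic copy of $K^{(3)}_t$, and let $c:E(H)\to[k]$ be such a coloring. Then there exists a $3$-uniform hypergraph $\mathcal{H}$ with the following properties: (1) there is a $k$-coloring of $E(\mathcal{H})$ with no monochromatic copy of $K^{(3)}_t$; (2) $\mathcal{H}$ contains $H$ as an induced subhypergraph; (3) for every coloring $\varphi:E(\mathcal{H})\to[k]$ with no monochromatic copy of $K^{(3)}_t$, the restriction of $\varphi$ to $E(H)$ agrees with $c$ up to a permutation of the $k$ colors; (4) if $a,b\in V(H)$ satisfy $\deg_H(a,b)=0$, then $\deg_{\mathcal{H}}(a,b)=0$; (5) if $|V(H)|\ge 4$, then for every vertex $x\in V(\mathcal{H})\setminus V(H)$ there exists a vertex $y\in V(H)$ with $\deg_{\mathcal{H}}(x,y)=0$.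
   Context: $K^{(3)}_t$ denotes the complete $3$-uniform hypergraph on $t$ vertices. For vertices $u,v$, the codegree $\deg_H(u,v)$ is the number of edges of $H$ containing both $u$ and $v$. *)

(* Defs.v *)
From mathcomp Require Import all_boot perm.

Set Implicit Arguments.
Unset Strict Implicit.
Unset Printing Implicit Defensive.

Record hypergraph3 := Hypergraph3 {
  vertex :> finType;
  edges : {set {set vertex}};
  card_edges : forall e, e \in edges -> #|e| = 3
}.

Definition complete_edges (t : nat) : {set {set 'I_t}} := [set e : {set 'I_t} | #|e| == 3].

Lemma card_complete_edges t (e : {set 'I_t}) :
  e \in complete_edges t -> #|e| = 3.
Proof. by rewrite inE => /eqP. Qed.

Definition complete3 (t : nat) : hypergraph3 :=
  Hypergraph3 (@card_complete_edges t).

Definition codeg (H : hypergraph3) (u v : H) : nat :=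
  #|[set e in edges H | (u \in e) && (v \in e)]|.

(* An edge colouring is represented by a total function on vertex sets; every
   notion below only inspects its values on edges. *)
Definition coloring (H : hypergraph3) (k : nat) := {set H} -> 'I_k.

(* The image of f is a not necessarily induced copy of F in H. *)
Definition is_copy (F H : hypergraph3) (f : F -> H) : Prop :=
  injective f /\ forall e : {set F}, e \in edges F -> f @: e \in edges H.

Definition has_mono_copy (F H : hypergraph3) (k : nat) (c : coloring H k) :
    Prop :=
  exists f : F -> H, is_copy f /\
    exists i : 'I_k, forall e : {set F}, e \in edges F -> c (f @: e) = i.

Definition mono_free (t : nat) (H : hypergraph3) (k : nat)
    (c : coloring H k) : Prop :=
  ~ has_mono_copy (complete3 t) c.

Definition induced_embedding (H G : hypergraph3) (f : H -> G) : Prop :=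
  injective f /\
  forall e : {set H}, (f @: e \in edges G) = (e \in edges H).

(* Main.v *)
(* Let F be an edge-maximal k-colourable (without monochromatic K_t) hypergraph on
   so many vertices that the complete hypergraph is not k-colourable, and let abd
   be a missing triple. No good colouring of F gives all the edges abx, x <> d,
   the same colour i: otherwise abd could be added with a colour other than i,
   since every clique through abd contains some abx.

   Copies of F that share the spine {a,b} and only pages x can be placed on the
   blocks of any linear set system (two blocks meet in at most one point) without
   creating new cliques. Placed on the blocks of a system that is not k-colourable
   they have no good colouring; undoing all identifications of pages and redoing
   them one at a time, the first identification that destroys all good colourings
   merges two pages that always have different colours. From k pages that are
   pairwise joined by such gadgets one gets k edges that are always rainbow, and
   two copies of this sharing k-1 pages force their last pages to agree. Chains of
   such equality gadgets connect two edges e, f with no edge meeting both. Finally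
   each edge e of H is linked in this way to the rainbow edge of index c(e). *)
Require Import Defs.
From mathcomp Require Import all_boot perm.
From Stdlib Require Import Classical.

Set Implicit Arguments.
Unset Strict Implicit.
Unset Printing Implicit Defensive.

(** * Ramsey's theorem *)

Lemma pigeonhole (T : finType) (k m : nat) (f : T -> 'I_k) (A : {set T}) :
  k * m < #|A| -> exists i, m < #|[set x in A | f x == i]|.
Proof.
move=> ltA; apply: NNPP => noi; move: ltA; apply/negP; rewrite -leqNgt.
rewrite -sum1_card (partition_big f xpredT) //=.
rewrite -[X in _ <= X * _]card_ord -sum_nat_const; apply: leq_sum => i _.
rewrite sum1dep_card leqNgt; apply/negP => lt_m; apply: noi; exists i.
by congr (m < _): lt_m; apply: eq_card => x; rewrite !inE.
Qed.

(** The Erdos-Rado device: the colour of an ([r]+1)-subset of [w] depends, through [d], only on its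
    element that comes first in [w]. *)
Fixpoint end_homogeneous (T : finType) (k r : nat) (c : {set T} -> 'I_k)
    (d : T -> 'I_k) (w : seq T) : Prop :=
  if w is x :: w' then
    (forall e : {set T}, {subset e <= w'} -> #|e| = r -> c (x |: e) = d x)
    /\ end_homogeneous r c d w'
  else True.

Lemma end_homogeneous_ext (T : finType) k r (c c' : {set T} -> 'I_k) d d' w :
  {in w, d =1 d'} -> (forall e, c e = c' e) ->
  end_homogeneous r c d w -> end_homogeneous r c' d' w.
Proof.
move=> + eqc; elim: w => //= x w IH eqd [Hx Hw]; split.
  by move=> e sew ce; rewrite -eqc Hx // eqd ?mem_head.
by apply: IH => // y yw; apply: eqd; rewrite inE yw orbT.
Qed.

Lemma end_homogeneous_color (T : finType) k r (c : {set T} -> 'I_k) d w i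
    (e : {set T}) :
  end_homogeneous r c d w -> {subset e <= w} -> #|e| = r.+1 ->
  {in e, forall z, d z = i} -> c e = i.
Proof.
elim: w => [|x w IH] /=.
  move=> _ sew ce; have /card_gt0P[z ze]: 0 < #|e| by rewrite ce.
  by have := sew _ ze.
case=> Hx Hw sew ce de; have [xe|xe] := boolP (x \in e).
  rewrite -(setD1K xe) Hx ?de //.
    by move=> z; rewrite !inE => /andP[zx /sew]; rewrite inE (negPf zx).
  by move: ce; rewrite (cardsD1 x) xe => -[].
apply: IH => // z ze; have := sew _ ze; rewrite inE => /orP[/eqP zx|//].
by rewrite -zx ze in xe.
Qed.

Definition ramsey_bound (r k t N : nat) : Prop :=
  forall (T : finType) (A : {set T}) (c : {set T} -> 'I_k), N <= #|A| ->
  exists (B : {set T}) (i : 'I_k), [/\ B \subset A, #|B| = t &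
    forall e : {set T}, e \subset B -> #|e| = r -> c e = i].

(** Greedy choice: after picking [x], Ramsey's theorem for [r]-sets, applied to the colouring
    sending [e] to [c (x |: e)], leaves a homogeneous set in which the rest of the sequence is
    chosen. *)
Lemma end_homogeneous_exists r k (k0 : 'I_k) s :
  (forall t, exists N, ramsey_bound r k t N) ->
  exists N, forall (T : finType) (A : {set T}) (c : {set T} -> 'I_k),
    N <= #|A| -> exists (w : seq T) (d : T -> 'I_k),
    [/\ uniq w, size w = s, {subset w <= A} & end_homogeneous r c d w].
Proof.
move=> Rr; elim: s => [|s [N IH]].
  by exists 0 => T A c _; exists [::], (fun=> k0).
have [M RM] := Rr N; exists M.+1 => T A c leA.
have /card_gt0P[x xA]: 0 < #|A| by apply: leq_trans leA.
have leAx : M <= #|A :\ x| by move: leA; rewrite (cardsD1 x) xA.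
have [B [i [sB cB hB]]] := RM _ _ (fun e => c (x |: e)) leAx.
have [|w [d [uw sw swB hw]]] := IH T B c; first by rewrite cB.
have xw : x \notin w.
  by apply/negP => /swB /(subsetP sB); rewrite !inE eqxx.
exists (x :: w), (fun z => if z == x then i else d z); split=> //=.
- by rewrite xw.
- by rewrite sw.
- by move=> z; rewrite inE => /orP[/eqP->//|/swB/(subsetP sB)/setD1P[]].
split.
  move=> e sew ce; rewrite eqxx; apply: hB => //.
  by apply/subsetP => z /sew /swB.
apply: (end_homogeneous_ext _ (fun=> erefl)) hw => z zw.
by case: eqP xw => // <-; rewrite zw.
Qed.

Lemma ramsey r k (k0 : 'I_k) t : exists N, ramsey_bound r k t N.
Proof.
elim: r t => [|r IH] t.
  exists t => T A c /card_geqP[w [uw sw swA]].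
  exists [set z in w], (c set0); split.
  - by apply/subsetP => z; rewrite inE => /swA.
  - by rewrite cardsE (card_uniqP uw).
  - by move=> e _ /eqP; rewrite cards_eq0 => /eqP->.
have [N HN] := end_homogeneous_exists k0 (k * t).+1 IH.
exists N => T A c leA; have [w [d [uw sw swA hw]]] := HN T A c leA.
(* Among [k * t + 1] elements more than [t] share their value of [d]; on the ([r]+1)-subsets of
   these, [c] is constant. *)
have [|i lti] := @pigeonhole T k t d [set z in w].
  by rewrite cardsE (card_uniqP uw) sw.
have /card_geqP[v [uv sv svw]] := ltnW lti.
have vP z : z \in v -> z \in w /\ d z = i.
  by move=> /svw; rewrite !inE => /andP[-> /eqP->].
exists [set z in v], i; split.
- by apply/subsetP => z; rewrite inE => /vP[/swA].
- by rewrite cardsE (card_uniqP uv).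
- move=> e /subsetP sev ce; apply: (end_homogeneous_color hw) ce _ => z ze;
    by have := sev _ ze; rewrite inE => /vP[].
Qed.

(** * A book that is never monochromatic *)

Lemma mono_freeP (t k : nat) (G : hypergraph3) (c : coloring G k) :
  mono_free t c <-> forall (f : 'I_t -> G) (i : 'I_k), injective f ->
    ~ forall e : {set 'I_t}, #|e| = 3 -> f @: e \in edges G /\ c (f @: e) = i.
Proof.
split=> [free f i injf mono|free [f [[injf cf] [i ci]]]].
  apply: free; exists f; split.
    by split=> // e; rewrite inE => /eqP/mono[].
  by exists i => e; rewrite inE => /eqP/mono[].
apply: (free f i injf) => e ce.
by split; [apply: cf|apply: ci]; rewrite inE ce.
Qed.

Lemma exists_card3 (t : nat) (P : {set 'I_t}) : 3 <= #|P| ->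
  exists e : {set 'I_t}, e \subset P /\ #|e| = 3.
Proof.
move=> /card_geqP[v [uv sv svP]]; exists [set z in v]; split.
  by apply/subsetP => z; rewrite inE => /svP.
by rewrite cardsE (card_uniqP uv).
Qed.

Lemma mono_free_no_edge (t k : nat) (G : hypergraph3) (c : coloring G k) :
  3 <= t -> edges G = set0 -> mono_free t c.
Proof.
move=> t3 G0; apply/mono_freeP => f i _ mono.
have [|e [_ ce]] := @exists_card3 t setT; first by rewrite cardsT card_ord.
by have [] := mono e ce; rewrite G0 inE.
Qed.

Lemma card_set3 (T : finType) (x y z : T) :
  x != y -> x != z -> y != z -> #|[set x; y; z]| = 3.
Proof.
move=> xy xz yz; rewrite setUC cardsU1 cards2 !inE xy.
by rewrite (eq_sym z x) (eq_sym z y) (negPf xz) (negPf yz).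
Qed.

Lemma card_set3_neq (T : finType) (x y z : T) :
  #|[set x; y; z]| = 3 -> [/\ x != y, x != z & y != z].
Proof.
rewrite setUC cardsU1 cards2 !inE (eq_sym z x) (eq_sym z y).
by case: (x != y); case: (x == z); case: (y == z).
Qed.

Lemma card3P (T : finType) (e : {set T}) : #|e| = 3 ->
  exists x y z, [/\ x != y, x != z, y != z & e = [set x; y; z]].
Proof.
move=> ce; have /card_gt0P[x xe]: 0 < #|e| by rewrite ce.
have cx : #|e :\ x| = 2 by move: ce; rewrite (cardsD1 x) xe => -[].
have /cards2P[y [z [yz E]]]: #|e :\ x| == 2 by rewrite cx.
have /setD1P[yx _] : y \in e :\ x by rewrite E !inE eqxx.
have /setD1P[zx _] : z \in e :\ x by rewrite E !inE eqxx orbT.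
exists x, y, z; split=> //; rewrite 1?eq_sym //.
by rewrite -(setD1K xe) E setUA.
Qed.

(** Filtering by size lets an arbitrary family be enlarged by any set, with no cardinality proof to
    carry along. *)
Definition triples_in (T : finType) (E : {set {set T}}) : {set {set T}} :=
  [set e in E | #|e| == 3].

Lemma card_triples_in (T : finType) (E : {set {set T}}) (e : {set T}) :
  e \in triples_in E -> #|e| = 3.
Proof. by rewrite inE => /andP[_ /eqP]. Qed.

Definition hypergraph_of (T : finType) (E : {set {set T}}) : hypergraph3 :=
  Hypergraph3 (@card_triples_in T E).

Section CriticalBook.
Variables k t : nat.
Hypotheses (k2 : 2 <= k) (t4 : 4 <= t).

Definition colorable (G : hypergraph3) : Prop :=
  exists c : coloring G k, mono_free t c.

Let k0 : 'I_k := Ordinal (ltnW k2).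

Lemma uncolorable_complete :
  exists N, ~ colorable (hypergraph_of [set: {set 'I_N}]).
Proof.
have [N RN] := ramsey 3 k0 t; exists N => -[c /mono_freeP free].
have [|B [i [_ cB mono]]] := RN _ [set: 'I_N] c; first by rewrite cardsT card_ord.
apply: (free (fun s => enum_val (cast_ord (esym cB) s)) i).
  by move=> s u /enum_val_inj/cast_ord_inj.
move=> e ce; have cfe: #|[set enum_val (cast_ord (esym cB) s) | s in e]| = 3.
  by rewrite card_imset // => s u /enum_val_inj/cast_ord_inj.
split; first by rewrite !inE cfe.
by apply: mono cfe; apply/subsetP => _ /imsetP[s _ ->]; apply: enum_valP.
Qed.

Lemma colorable_maximal (T : finType) (E0 : {set {set T}}) :
  colorable (hypergraph_of E0) -> exists E : {set {set T}},
    colorable (hypergraph_of E) /\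
    forall e, e \notin E -> ~ colorable (hypergraph_of (e |: E)).
Proof.
have [n] := ubnP #|~: E0|; elim: n E0 => // n IH E0 leE gE.
case: (classic (exists e, e \notin E0 /\ colorable (hypergraph_of (e |: E0)))).
  case=> e [eE ge]; apply: IH ge; rewrite -ltnS; apply: leq_trans leE.
  rewrite ltnS [#|~: E0|](cardsD1 e) inE eE ltnS; apply: subset_leq_card.
  by apply/subsetP => x; rewrite !inE negb_or.
move=> no; exists E0; split=> // e eE ge; apply: no; by exists e.
Qed.

(* Were all pages of the same colour, the missing triple of a maximal colourable
   hypergraph could be added with any other colour: every new clique contains
   one of the pages. *)
Lemma critical_book : exists (F : hypergraph3) (a b : F) (X : {set F}),
  [/\ [/\ a != b, a \notin X & b \notin X],
      forall x, x \in X -> [set a; b; x] \in edges F,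
      colorable F &
      forall (phi : coloring F k) i, mono_free t phi ->
        ~ forall x, x \in X -> phi [set a; b; x] = i].
Proof.
have [N bad] := uncolorable_complete.
have [|E [gE maxE]] := @colorable_maximal 'I_N set0.
  exists (fun=> k0); apply: mono_free_no_edge; first exact: ltnW.
  by apply/setP => e; rewrite !inE.
(* Otherwise [E] would contain all triples, and its good colouring would colour the complete
   hypergraph. *)
have [e [ce eE]]: exists e : {set 'I_N}, #|e| = 3 /\ e \notin E.
  apply: NNPP => none; apply: bad; case: gE => c /mono_freeP free.
  exists c; apply/mono_freeP => f i injf mono; apply: (free f i injf) => e ce.
  have [+ ->] := mono e ce; rewrite !inE /= => cfe; rewrite cfe andbT; split=> //.
  by apply/negPn/negP => feE; apply: none; exists (f @: e); rewrite (eqP cfe).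
have [a [b [d [ab ad bd eabd]]]] := card3P ce.
exists (hypergraph_of E), a, b,
  [set x | (x != d) && ([set a; b; x] \in edges (hypergraph_of E))].
split=> //.
- by split=> //; apply/negP; rewrite !inE => /andP[_ /andP[_ /eqP/card_set3_neq[]]];
    rewrite ?eqxx.
- by move=> x; rewrite !inE => /andP[].
move=> phi i /mono_freeP free pages; apply: (maxE e eE).
have [j ji]: exists j : 'I_k, j != i.
  have lt1 : 1 < k := k2; exists (if i == k0 then Ordinal lt1 else k0).
  by have [->|] := eqVneq i k0; rewrite // eq_sym.
exists (fun e' => if e' == e then j else phi e').
apply/mono_freeP => f l injf mono.
have [eT|eT] := boolP [exists e' : {set 'I_t}, (#|e'| == 3) && (f @: e' == e)]; last first.
  apply: (free f l injf) => e' ce'; have [+ +] := mono _ ce'.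
  have fe' : f @: e' != e.
    by apply: contra eT => ?; apply/existsP; exists e'; rewrite ce'.
  by rewrite (negPf fe') !inE (negPf fe').
have [e' /andP[/eqP ce' /eqP fe']] := existsP eT.
have [_] := mono _ ce'; rewrite fe' eqxx => jl.
have im x : x \in e -> exists s, x = f s.
  by rewrite -fe' => /imsetP[s _ ->]; exists s.
have [[sa Ea] [sb Eb]]: (exists s, a = f s) /\ (exists s, b = f s).
  by split; apply: im; rewrite eabd !inE eqxx ?orbT.
(* Since [t >= 4], the clique through [e] has a vertex outside [e]; with [a] and [b] it spans a page
   edge, of colour [i], whereas [e] has colour [j]. *)
have /card_gt0P[s se']: 0 < #|~: e'| by rewrite cardsCs setCK card_ord ce' subn_gt0.
have fse : f s \notin e.
  rewrite -fe'; apply/imsetP => -[s' s'e /injf ss']; move: se'.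
  by rewrite inE ss' s'e.
have [nsa nsb] : f s != a /\ f s != b.
  by split; apply: contraNneq fse => ->; rewrite eabd !inE eqxx ?orbT.
have nsd : f s != d by apply: contraNneq fse => ->; rewrite eabd !inE eqxx ?orbT.
have Eim : f @: [set sa; sb; s] = [set a; b; f s].
  by rewrite !imsetU !imset_set1 -Ea -Eb.
have cabs : #|[set sa; sb; s]| = 3.
  apply: card_set3; first by apply: contraNneq ab => E'; rewrite Ea Eb E'.
    by apply: contraNneq nsa => <-; rewrite -Ea.
  by apply: contraNneq nsb => <-; rewrite -Eb.
have ne : [set a; b; f s] != e.
  by apply: contraNneq fse => <-; rewrite !inE eqxx orbT.
have [] := mono _ cabs; rewrite Eim (negPf ne) !inE (negPf ne) /= => sE col.
suff: phi [set a; b; f s] = i by move=> E'; move: ji; rewrite jl -col E' eqxx.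
by apply: pages; rewrite !inE nsd.
Qed.
End CriticalBook.

(** * Linear systems *)

(** Blocks are labelled by [S] because the pages of the book placed on a block are not
    interchangeable. *)
Record linear_system (S : finType) := LinearSystem {
  point : finType;
  block : finType;
  pt : block -> S -> point;
  pt_inj : forall e, injective (pt e);
  pt_linear : forall e e' s s' u u',
    s != u -> pt e s = pt e' s' -> pt e u = pt e' u' -> e = e'
}.
Arguments pt {S l} _ _.

(* How a copy of [Q] sits in a glueing: its ports land on prescribed elements of
   the common part [U], all its other elements become new ones. *)
Section Attach.
Variables (D Q U R : finType) (port : D -> Q) (tgt : D -> U) (dflt : Q -> R).
Hypothesis inj_port : injective port.

Definition attach (z : Q) : U + R :=
  if [pick d | port d == z] is Some d then inl (tgt d) else inr (dflt z).

Lemma attach_port d : attach (port d) = inl (tgt d).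
Proof.
rewrite /attach; case: pickP => [d' /eqP/inj_port->//|/(_ d)].
by rewrite eqxx.
Qed.

Lemma attach_inl z u : attach z = inl u -> exists d, z = port d /\ u = tgt d.
Proof. by rewrite /attach; case: pickP => // d /eqP <- [<-]; exists d. Qed.

Lemma attach_inr z r :
  attach z = inr r -> dflt z = r /\ forall d, port d != z.
Proof. by rewrite /attach; case: pickP => // no [<-]; split=> // d; rewrite no. Qed.

Lemma attach_inj : injective tgt -> injective dflt -> injective attach.
Proof.
move=> inj_tgt inj_dflt z z'; case E: (attach z) => [u|r] /esym E'.
  have [d [-> ud]] := attach_inl E; have [d' [-> ud']] := attach_inl E'.
  by congr port; apply: inj_tgt; rewrite -ud -ud'.
have [Er _] := attach_inr E; have [Er' _] := attach_inr E'.
by apply: inj_dflt; rewrite Er Er'.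
Qed.
End Attach.

(** * Linear systems with a monochromatic block in every colouring *)

Section LinearNoncolorable.
Variables (S : finType) (k : nat).
Hypothesis k0 : 0 < k.
Let a := (k * #|S|).+1.

(** Invariant of the Nesetril-Rodl partite construction: blocks meet each part at most once, and
    only colourings constant on the parts from [i] on are controlled. Raising [i] to [a] removes
    this restriction. *)
Definition parted (L : linear_system S) (part : point L -> 'I_a) (i : nat) :=
  (forall e s u, part (pt e s) = part (pt e u) -> s = u) /\
  forall chi : point L -> 'I_k,
    (forall y z, part y = part z -> i <= part y -> chi y = chi z) ->
    exists e j, forall s, chi (pt e s) = j.

(** Disjoint blocks, one for each injection of [S] into the parts. A colouring constant on parts is
    a colouring of the [k * #|S| + 1] parts, so some colour has enough parts to hold a whole
    block. *)
Lemma parted0 : exists L part, @parted L part 0.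
Proof.
pose B := {g : {ffun S -> 'I_a} | injectiveb g}.
pose mk (g : {ffun S -> 'I_a}) (ginj : injectiveb g) : B := Sub g ginj.
pose p (g : B) (s : S) : B * S := (g, s).
have pinj e : injective (p e) by move=> s u [].
have plin (e e' : B) s s' u u' :
  s != u -> p e s = p e' s' -> p e u = p e' u' -> e = e' by move=> _ [].
exists (LinearSystem pinj plin), (fun y : B * S => val y.1 y.2); split=> /=.
  by move=> [g ginj] s u; exact: (injectiveP _ ginj).
move=> chi cst.
(* A part gets the colour of any of its points; the default serves only parts without points. *)
pose rep (j : 'I_a) : 'I_k :=
  if [pick y : B * S | val y.1 y.2 == j] is Some y then chi y else Ordinal k0.
have [|j ltj] := @pigeonhole 'I_a k #|S| rep setT; first by rewrite cardsT card_ord.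
have [s0 _|S0] := pickP (mem S); last first.
  have ginj : injectiveb [ffun s : S => ord0 : 'I_a].
    by apply/injectiveP => s; have := S0 s.
  by exists (mk _ ginj), j => s; have := S0 s.
set J := [set x in setT | _] in ltj.
pose g := [ffun s : S => enum_val (widen_ord (ltnW ltj) (enum_rank s))].
have ginj : injectiveb g.
  apply/injectiveP => s u; rewrite !ffunE => /enum_val_inj E.
  by apply: enum_rank_inj; apply: val_inj; case: E.
exists (mk _ ginj), j => s.
have /eqP : rep (g s) == j.
  have := enum_valP (widen_ord (ltnW ltj) (enum_rank s)).
  by rewrite !inE ffunE.
rewrite /rep; case: pickP => [y /eqP yE <-|].
  by apply: cst => //=.
by move/(_ (mk _ ginj, s)); rewrite /= eqxx.
Qed.

(* Copies of [L] are glued along the part [i] in all possible ways, into a set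
   so large that every colouring is constant on the [i]-th part of one copy. *)
Lemma partedS L part (i : 'I_a) : @parted L part i ->
  exists L' part', @parted L' part' i.+1.
Proof.
case=> trans mono; pose K := 'I_(k * #|point L|).+1.
pose G := {g : {ffun point L -> K} | injectiveb g}.
pose h (g : G) (y : point L) : K + G * point L :=
  if part y == i then inl (val g y) else inr (g, y).
have hinj g : injective (h g).
  move=> y z; rewrite /h; case: eqP => _; case: eqP => _ // [] //.
  by case: g => g ginj; exact: (injectiveP _ ginj).
have hpart g g' y y' : h g y = h g' y' -> g != g' -> part y = i.
  rewrite /h; case: eqP => // _; case: eqP => // _ [-> _].
  by rewrite eqxx.
pose p (e : G * block L) s := h e.1 (pt e.2 s).
have pinj e : injective (p e) by move=> s u /hinj/pt_inj.
have plin (e e' : G * block L) s s' u u' :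
    s != u -> p e s = p e' s' -> p e u = p e' u' -> e = e'.
  case: e e' => [g e] [g' e'] su; rewrite /p /= => E1 E2.
  (* Distinct copies meet only in part [i], where a block has at most one point, so two common
     points force [g = g']. *)
  have [gg|gg] := eqVneq g g'; last first.
    have := trans e s u; rewrite (hpart _ _ _ _ E1 gg) (hpart _ _ _ _ E2 gg).
    by move=> /(_ erefl) E; rewrite E eqxx in su.
  by rewrite -gg in E1 E2 *; move: E1 E2 => /hinj E1 /hinj/(pt_linear su E1)->.
pose part' (y : K + G * point L) := if y is inr y' then part y'.2 else i.
have part'h g y : part' (h g y) = part y.
  by rewrite /h; case: eqP => [->|].
exists (LinearSystem pinj plin), part'; split=> /=.
  by move=> [g e] s u; rewrite /p !part'h; apply: trans.
move=> chi cst.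
have [|j ltj] := @pigeonhole K k #|point L| (fun x => chi (inl x)) setT.
  by rewrite cardsT card_ord.
set J := [set x in setT | _] in ltj.
(* All values of [g] are elements of [K] of the single colour [j], so its copy of [L] is constant on
   part [i] as well. *)
pose g := [ffun y : point L => enum_val (widen_ord (ltnW ltj) (enum_rank y))].
have ginj : injectiveb g.
  apply/injectiveP => s u; rewrite !ffunE => /enum_val_inj E.
  by apply: enum_rank_inj; apply: val_inj; case: E.
have gj y : chi (inl (g y)) = j.
  have := enum_valP (widen_ord (ltnW ltj) (enum_rank y)).
  by rewrite !inE ffunE => /eqP.
pose g' : G := Sub g ginj.
have [y z yz|e [l el]] := mono (fun y => chi (h g' y)).
  rewrite leq_eqVlt => /orP[/eqP iy|iy]; last by apply: cst; rewrite !part'h.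
  have yi : part y = i by apply: val_inj.
  by rewrite /h -yz yi eqxx !gj.
by exists (g', e), l.
Qed.

Lemma linear_noncolorable : exists L : linear_system S,
  forall chi : point L -> 'I_k, exists e j, forall s, chi (pt e s) = j.
Proof.
suff /(_ a (leqnn a))[L [part [_ mono]]] :
    forall i, i <= a -> exists L part, @parted L part i; last first.
  elim=> [_|i IH lti]; first exact: parted0.
  by have [L [part HL]] := IH (ltnW lti); apply: (@partedS L part (Ordinal lti)).
exists L => chi; apply: mono => y z _.
by rewrite leqNgt ltn_ord.
Qed.
End LinearNoncolorable.

Lemma perm_two (T : finType) (a b c d : T) : a != b -> c != d ->
  exists s : {perm T}, s a = c /\ s b = d.
Proof.
move=> ab cd; exists (tperm a c * tperm (tperm a c b) d)%g.
rewrite !permM tpermL [tperm _ d (tperm a c b)]tpermL; split=> //.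
rewrite tpermD ?(eq_sym d) //.
by rewrite -{2}(tpermL a c) (inj_eq perm_inj) eq_sym.
Qed.

Lemma first_failure (P : nat -> Prop) (M : nat) :
  P 0 -> ~ P M -> exists n, [/\ n < M, P n & ~ P n.+1].
Proof.
move=> P0; elim: M => // M IH nP; have [PM|/IH[n [ltn Pn nPn]]] := classic (P M).
  by exists M.
by exists n; split=> //; apply: ltnW.
Qed.

(** * Points forced to have different or equal colours *)

Section Systems.
Variables (S : finType) (k : nat) (A : (S -> 'I_k) -> Prop).
Hypotheses (k2 : 2 <= k)
  (A_ext : forall chi chi', chi =1 chi' -> A chi -> A chi')
  (A_ex : exists chi, A chi)
  (A_perm : forall (s : {perm 'I_k}) chi, A chi -> A (s \o chi))
  (A_nonconst : forall chi i, A chi -> ~ forall s, chi s = i).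

Let k0 : 'I_k := Ordinal (ltnW k2).

(** [A] stands for the colour patterns that good colourings of the book produce on its pages; a
    solution shows such a pattern on every block. *)
Definition solution (L : linear_system S) (chi : point L -> 'I_k) : Prop :=
  forall e, A (fun s => chi (pt e s)).

(** Glueing copies of a system at separated points keeps it linear, since no block contains two
    glueing points. *)
Definition separated (L : linear_system S) (v v' : point L) : Prop :=
  forall e s s', pt e s = v -> pt e s' <> v'.

Definition covered (L : linear_system S) (v : point L) : Prop :=
  exists e s, pt e s = v.

(* All incidences (block, position) of an unsolvable system are separated and
   then identified one at a time; the first identification that makes the system
   unsolvable merges two points that always had different colours. *)
Lemma distinct_pair : exists (L : linear_system S) (v v' : point L),
  [/\ separated v v', covered v, covered v', exists chi, solution (L := L) chi &
      forall chi, solution (L := L) chi -> chi v != chi v'].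
Proof.
have [L unsat] := linear_noncolorable S (ltnW k2).
(* In the [n]-th system, incidences of rank below [n] are merged into the points of [L]; the others
   remain points of their own. *)
pose p n (e : block L) s : point L + block L * S :=
  if enum_rank (e, s) < n then inl (pt e s) else inr (e, s).
have pinj n e : injective (p n e).
  move=> s u; rewrite /p; case: ifP => _; case: ifP => _ // [] //.
  exact: pt_inj.
have plin n (e e' : block L) s s' u u' :
    s != u -> p n e s = p n e' s' -> p n e u = p n e' u' -> e = e'.
  move=> su; rewrite /p; do 2?[case: ifP => _; case: ifP => _ //]; move=> [].
  - by move=> E1 [E2]; apply: pt_linear su E1 E2.
  - by move=> E1 [-> _].
  - by move=> -> _.
  - by move=> -> _.
pose Ln n := LinearSystem (pinj n) (plin n).
have [chi0 A0] := A_ex.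
have sat0 : exists chi, solution (L := Ln 0) chi.
  exists (fun y : point L + block L * S => if y is inr z then chi0 z.2 else k0).
  by move=> e; apply: A_ext A0.
have unsatM : ~ exists chi, solution (L := Ln #|{: block L * S}|) chi.
  case=> chi sol; have [e [j cst]] := unsat (fun y => chi (inl y)).
  apply: (A_nonconst (i := j) (sol e)) => s.
  by rewrite -[RHS](cst s) /= /p ltn_ord.
have [n [ltn sat unsatS]] := first_failure (P := fun n =>
  exists chi, solution (L := Ln n) chi) sat0 unsatM.
pose z := enum_val (Ordinal ltn).
have rz : enum_rank z = n :> nat by rewrite enum_valK.
have pz : p n z.1 z.2 = inr z by rewrite /p -surjective_pairing rz ltnn.
pose v : point (Ln n) := inr z; pose v' : point (Ln n) := inl (pt z.1 z.2).
(* Only the block of [z] contains [v], and by injectivity it could meet [v'] only in the incidence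
   [z] itself, which is not yet merged. *)
have sepv : separated v v'.
  move=> e s s' /=; rewrite {1}/p; case: ifP => // _ [ez].
  rewrite /p; case: ifP => // lts' [].
  rewrite -ez /= => /pt_inj ss'; move: lts'; rewrite ss'.
  by rewrite ez rz ltnn.
(* The next system only moves the incidence [z] from [v] to [v'], so a solution with equal colours
   there would solve it as well. *)
have neq chi : solution (L := Ln n) chi -> chi v != chi v'.
  move=> sol; apply/eqP => E; apply: unsatS; exists chi => e.
  apply: A_ext (sol e) => s /=.
  have [Ez|nz] := eqVneq (e, s) z.
    have -> : p n e s = v by rewrite /v -pz -Ez.
    have -> : p n.+1 e s = v' by rewrite /p Ez rz ltnSn /v' -Ez.
    exact: E.
  rewrite /p [_ < n.+1]ltnS [in RHS]leq_eqVlt.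
  have /negPf-> // : nat_of_ord (enum_rank (e, s)) != n.
  apply: contra nz => /eqP E'; apply/eqP/enum_rank_inj/val_inj.
  by rewrite /= E' rz.
exists (Ln n), v, v'; split=> //; first by exists z.1, z.2.
(* If no block contained [v'], it could be given the colour of [v] without affecting any block. *)
apply: NNPP => ncov; have [chi sol] := sat.
pose chi' y := if y == v' then chi v else chi y.
have sol' : solution (L := Ln n) chi'.
  move=> e; apply: A_ext (sol e) => s; rewrite /chi'.
  by case: eqP => // E; case: ncov; exists e, s.
by case/eqP: (neq _ sol'); rewrite /chi' eqxx; case: (v == v').
Qed.

Lemma separated_neq (L : linear_system S) (v v' : point L) :
  covered v -> separated v v' -> v != v'.
Proof. by move=> [e [s E]] sep; apply/eqP => vv'; apply: (sep e s s); rewrite ?E. Qed.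

(** One copy of the distinct-pair system for each ordered pair of different colours [i], [j], its
    two special points being identified with the [i]-th and [j]-th of [k] common points. *)
Lemma rainbow_points : exists (L : linear_system S) (v : 'I_k -> point L),
  [/\ forall i j, i != j -> separated (v i) (v j), forall i, covered (v i),
      exists chi, solution (L := L) chi &
      forall chi, solution (L := L) chi -> injective (chi \o v)].
Proof.
have [L [v0 [v1 [sep cov0 cov1 sat neq]]]] := distinct_pair.
pose P := {p : 'I_k * 'I_k | p.1 != p.2}.
pose port b := if b then v0 else v1.
have v01 := separated_neq cov0 sep.
have inj_port : injective port.
  by case=> [] [] //= E; move: v01; rewrite E eqxx.
pose tgt (p : P) (b : bool) := if b then (val p).1 else (val p).2.
have inj_tgt p : injective (tgt p).
  by case: p => p pE [] [] //= E; move: pE; rewrite E eqxx.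
pose h (p : P) : point L -> 'I_k + P * point L :=
  attach port (tgt p) (fun y => (p, y)).
have hinj p : injective (h p) by apply: attach_inj => // y z [].
pose q (e : P * block L) s := h e.1 (pt e.2 s).
have qinj e : injective (q e) by move=> s u /hinj/pt_inj.
have hport p p' y y' : h p y = h p' y' -> p != p' -> exists b, y = port b.
  case E: (h p y) => [i|r] /esym E'; first by case: (attach_inl E) => b [->]; exists b.
  have [Er _] := attach_inr E; have [Er' _] := attach_inr E'.
  by move: Er'; rewrite -Er => -[->]; rewrite eqxx.
have qlin (e e' : P * block L) s s' u u' :
    s != u -> q e s = q e' s' -> q e u = q e' u' -> e = e'.
  case: e e' => [p e] [p' e'] su; rewrite /q /= => E1 E2.
  have [pp|pp] := eqVneq p p'.
    by rewrite -pp in E1 E2 *; move: E1 E2 => /hinj E1 /hinj/(pt_linear su E1)->.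
  have [b Eb] := hport _ _ _ _ E1 pp; have [b' Eb'] := hport _ _ _ _ E2 pp.
  have bb' : b != b'.
    by apply: contraNneq su => bb'; apply/eqP/(@pt_inj _ _ e); rewrite Eb Eb' bb'.
  by case: b b' bb' Eb Eb' => [] [] // _ Eb Eb'; [case: (sep e s u)|case: (sep e u s)].
pose L' := LinearSystem qinj qlin.
have covE (p : P) b : exists e s, q e s = inl (tgt p b).
  have [e [s E]] : covered (port b).
    by case: b.
  by exists (p, e), s; rewrite /q /= E /h attach_port.
have other (i : 'I_k) : exists j, i != j.
  have lt1 : 1 < k := k2; exists (if i == k0 then Ordinal lt1 else k0).
  by have [->|] := eqVneq i k0.
exists L', inl; split.
- move=> i j ij [p e] s s' /= E E'.
  have [b [Eb ib]] := attach_inl E; have [b' [Eb' jb']] := attach_inl E'.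
  have bb' : b != b' by apply: contraNneq ij => bb'; rewrite ib jb' bb'.
  by case: b b' bb' Eb Eb' {ib jb'} => [] [] // _ Eb Eb';
    [case: (sep e s s')|case: (sep e s' s)].
- by move=> i; have [j ij] := other i; apply: (covE (Sub (i, j) ij : P) true).
(* Giving colour [i] to the [i]-th common point extends to each copy, after a permutation of colours
   that adjusts its two ports. *)
- have : forall p : P, exists chi : {ffun point L -> 'I_k},
      [/\ solution (L := L) chi, chi v0 = (val p).1 & chi v1 = (val p).2].
    move=> p; have [chi sol] := sat.
    have [s [s0 s1]] := perm_two (neq _ sol) (valP p).
    exists [ffun y => s (chi y)]; rewrite !ffunE; split=> // e.
    by apply: A_ext (A_perm s (sol e)) => u; rewrite /= ffunE.
  move=> /fin_all_exists[X HX].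
  exists (fun y : 'I_k + P * point L => match y with inl i => i | inr z => X z.1 z.2 end).
  move=> [p e]; have [sol X0 X1] := HX p; apply: A_ext (sol e) => s /=.
  rewrite /q /=; case E: (h p (pt e s)) => [i|r].
    by have [[] [-> ->]] := attach_inl E.
  by have [<-] := attach_inr E.
move=> chi sol i j /= E; apply/eqP/negPn/negP => ij.
pose p : P := Sub (i, j) ij.
have /neq : solution (L := L) (chi \o h p) by move=> e; apply: (sol (p, e)).
rewrite /= -[v0]/(port true) -[v1]/(port false) /h !attach_port // /tgt /=.
by rewrite E eqxx.
Qed.

(* Two rainbow systems that share all rainbow points but one: the colour left for
   the last point is the same in both. *)
Lemma equal_pair : exists (L : linear_system S) (v v' : point L),
  [/\ [/\ separated v v', covered v & covered v'],
      exists chi, solution (L := L) chi &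
      forall chi, solution (L := L) chi -> chi v = chi v'].
Proof.
have [L [v [sep cov sat rainbow]]] := rainbow_points.
have vinj : injective v.
  have [chi /rainbow inj] := sat; move=> i j E; apply: inj.
  by rewrite /= E.
pose D := {i : 'I_k | i != k0}; pose port (d : D) := v (val d).
have inj_port : injective port by move=> d d' /vinj/val_inj.
(* Copy [true] is [L] itself; copy [false] is attached to it at every rainbow point except the one
   of index [k0]. *)
pose h (b : bool) : point L -> point L + point L :=
  if b then inl else attach port port id.
have hinj b : injective (h b).
  by case: b => [y z []|] //; apply: attach_inj.
have hport b b' y y' : h b y = h b' y' -> b != b' -> exists d, y = port d.
  case: b b' => [] [] // E _; last by have [d [-> _]] := attach_inl E; exists d.
  by have [d [_ ->]] := attach_inl (esym E); exists d.
pose q (e : bool * block L) s := h e.1 (pt e.2 s).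
have qinj e : injective (q e) by move=> s u /hinj/pt_inj.
have qlin (e e' : bool * block L) s s' u u' :
    s != u -> q e s = q e' s' -> q e u = q e' u' -> e = e'.
  case: e e' => [b e] [b' e'] su; rewrite /q /= => E1 E2.
  have [bb|bb] := eqVneq b b'.
    by rewrite -bb in E1 E2 *; move: E1 E2 => /hinj E1 /hinj/(pt_linear su E1)->.
  have [d Ed] := hport _ _ _ _ E1 bb; have [d' Ed'] := hport _ _ _ _ E2 bb.
  have dd' : val d != val d'.
    by apply: contraNneq su => dd'; apply/eqP/(@pt_inj _ _ e); rewrite Ed Ed' /port dd'.
  by case: (sep _ _ dd' e s u).
pose L' := LinearSystem qinj qlin.
have vport d : port d != v k0 by rewrite (inj_eq vinj); apply: (valP d).
have hk0 : h false (v k0) = inr (v k0).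
  rewrite /= ; case E: (attach _ _ _ _) => [y|y].
    by have [d [Ed _]] := attach_inl E; move: (vport d); rewrite Ed eqxx.
  by have [->] := attach_inr E.
exists L', (inl (v k0)), (inr (v k0)); split.
- split.
  + move=> [[] e] s s' //= E _.
    by have [d [_ Ed]] := attach_inl E; move: (vport d); rewrite Ed eqxx.
  + by have [e [s E]] := cov k0; exists (true, e), s; rewrite /= /q /= E.
  + by have [e [s E]] := cov k0; exists (false, e), s; rewrite /= /q [_.2]/= E hk0.
- have [chi sol] := sat; exists (fun y : point L + point L =>
    match y with inl z => chi z | inr z => chi z end).
  move=> [[] e]; apply: A_ext (sol e) => s //=; rewrite /q /=.
  case E: (attach _ _ _ _) => [y|y].
    by have [d [-> ->]] := attach_inl E.
  by have [<-] := attach_inr E.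
move=> chi sol.
have /rainbow inj1 : solution (L := L) (chi \o h true) by move=> e; apply: (sol (true, e)).
have /rainbow inj2 : solution (L := L) (chi \o h false) by move=> e; apply: (sol (false, e)).
rewrite -[inl _]/(h true (v k0)) -hk0.
(* The rainbow points of the second copy show all [k] colours, so one of them, of index [j], has the
   colour of [v k0] in the first copy. If [j != k0] it is shared, against the rainbow property of
   the first copy. *)
have [g _ gK] := injF_bij inj2.
have := gK (chi (h true (v k0))); set j := g _ => Ej.
have [jk|jk] := eqVneq j k0; first by rewrite -Ej /= jk.
have Ed : h false (v j) = h true (v j).
  exact: (attach_port port id inj_port (Sub j jk : D)).
case/eqP: jk; apply: inj1; rewrite -[LHS]/(chi (h true (v j))) -Ed; exact: Ej.
Qed.
End Systems.

Lemma mono_free_ext (t k : nat) (G : hypergraph3) (c c' : coloring G k) :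
  (forall e, e \in edges G -> c e = c' e) -> mono_free t c -> mono_free t c'.
Proof.
move=> eqc /mono_freeP free; apply/mono_freeP => f i injf mono.
apply: (free f i injf) => e /mono[fe cfe]; split=> //.
by rewrite eqc.
Qed.

Lemma mono_free_perm (t k : nat) (G : hypergraph3) (c : coloring G k)
    (s : {perm 'I_k}) :
  mono_free t c -> mono_free t ((fun e => s (c e)) : coloring G k).
Proof.
move=> /mono_freeP free; apply/mono_freeP => f i injf mono.
apply: (free f (s^-1%g i) injf) => e /mono[fe cfe]; split=> //.
by rewrite -cfe permK.
Qed.

(** * Glueing hypergraphs *)

Section Glue.
Variables (V I : finType) (Q : I -> hypergraph3) (h : forall i, Q i -> V).
Hypothesis h_inj : forall i, injective (h (i := i)).

Definition glue_edges : {set {set V}} :=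
  \bigcup_i [set h (i := i) @: X | X : {set Q i} in edges (Q i)].

Lemma glue_edgesP (e : {set V}) :
  reflect (exists i (X : {set Q i}), X \in edges (Q i) /\ e = h (i := i) @: X)
    (e \in glue_edges).
Proof.
apply: (iffP bigcupP) => [[i _ /imsetP[X XQ ->]]|[i [X [XQ ->]]]].
  by exists i, X.
by exists i => //; apply/imsetP; exists X.
Qed.

Lemma card_glue_edges (e : {set V}) : e \in glue_edges -> #|e| = 3.
Proof.
case/glue_edgesP => i [X [XQ ->]]; rewrite card_imset //.
exact: card_edges XQ.
Qed.

Definition glue : hypergraph3 := Hypergraph3 card_glue_edges.

Lemma glue_edge i (X : {set Q i}) :
  X \in edges (Q i) -> h (i := i) @: X \in edges glue.
Proof. by move=> XQ; apply/glue_edgesP; exists i, X. Qed.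

(** The piece is an induced subhypergraph of the glueing, so a clique within its vertices comes from
    a clique of [Q p]. *)
Definition induced_piece (p : I) : Prop :=
  forall q (X : {set Q q}), X \in edges (Q q) ->
    {subset h (i := q) @: X <= codom (h (i := p))} ->
    exists2 Y : {set Q p}, Y \in edges (Q p) & h (i := q) @: X = h (i := p) @: Y.

Variables t k : nat.

Definition clique (G : hypergraph3) (f : 'I_t -> G) : Prop :=
  injective f /\ forall e : {set 'I_t}, #|e| = 3 -> f @: e \in edges G.

Lemma mono_free_piece (phi : coloring glue k) i :
  mono_free t phi ->
  mono_free t ((fun X => phi (h (i := i) @: X)) : coloring (Q i) k).
Proof.
move=> /mono_freeP free; apply/mono_freeP => f j injf mono.
apply: (free (fun s => h (f s) : glue) j); first by move=> s u /h_inj/injf.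
move=> e /mono[fe cfe]; rewrite imset_comp; split=> //.
exact: glue_edge.
Qed.

(** Each triple [i], [j], [l] gives an edge of some piece, and the hypothesis on [f i] and [f j]
    makes it the same piece for all [l]. *)
Lemma clique_in_piece (f : 'I_t -> glue) i j : 3 <= t -> clique f -> i != j ->
  (forall p q, f i \in codom (h (i := p)) -> f j \in codom (h (i := p)) ->
     f i \in codom (h (i := q)) -> f j \in codom (h (i := q)) -> p = q) ->
  exists p, forall l, f l \in codom (h (i := p)).
Proof.
move=> t3 [injf cf] ij uniq_p.
have cov l : l != i -> l != j -> exists p, forall m,
    m \in [set i; j; l] -> f m \in codom (h (i := p)).
  move=> li lj; have c3 : #|[set i; j; l]| = 3 by rewrite card_set3 // eq_sym.
  have /glue_edgesP[p [X [_ E]]] := cf _ c3; exists p => m ml.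
  have : f m \in f @: [set i; j; l] by apply: imset_f.
  by rewrite E => /imsetP[x _ ->]; apply: codom_f.
have /card_gt0P[l0]: 0 < #|~: [set i; j]|.
  by rewrite cardsCs setCK card_ord cards2 ij subn_gt0.
rewrite !inE negb_or => /andP[l0i l0j].
have [p Hp] := cov l0 l0i l0j; exists p => l.
have [Pi Pj] : f i \in codom (h (i := p)) /\ f j \in codom (h (i := p)).
  by split; apply: Hp; rewrite !inE eqxx ?orbT.
have [->//|li] := eqVneq l i; have [->//|lj] := eqVneq l j.
have [q Hq] := cov l li lj.
rewrite (uniq_p p q) //; apply: Hq; by rewrite !inE eqxx ?orbT.
Qed.

Lemma mono_free_glue (phi : coloring glue k) :
  (forall i, mono_free t ((fun X => phi (h (i := i) @: X)) : coloring (Q i) k)) ->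
  (forall f : 'I_t -> glue, clique f ->
     exists2 p, induced_piece p & forall l, f l \in codom (h (i := p))) ->
  mono_free t phi.
Proof.
move=> free loc; apply/mono_freeP => f j injf mono.
have [|p ind_p fp] := loc f; first by split=> // e /mono[].
have /mono_freeP/(_ (fun l => iinv (fp l)) j) := free p; apply.
  by move=> l m E; apply: injf; rewrite -(f_iinv (fp l)) E f_iinv.
move=> e /mono[fe cfe].
have E : h (i := p) @: [set iinv (fp l) | l in e] = f @: e.
  by rewrite -imset_comp; apply: eq_imset => l /=; rewrite f_iinv.
rewrite E; split=> //.
have /glue_edgesP[q [X [XQ EX]]] := fe.
have [|Y YQ EY] := ind_p q X XQ.
  by move=> x; rewrite -EX => /imsetP[l _ ->].
suff -> : [set iinv (fp l) | l in e] = Y by [].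
by apply: (imset_inj (@h_inj p)); rewrite E EX EY.
Qed.
End Glue.

(* The points of [L] become pages over the common spine [sp true, sp false], and
   a copy of the book [F] is glued onto the pages of each block. Two pages of a
   clique determine the block, by linearity, so a clique lies in a single copy. *)
Section BookSystem.
Variables (k t : nat) (F : hypergraph3) (a b : F) (X : {set F}).
Hypotheses (t4 : 4 <= t) (k0 : 'I_k) (ab : a != b) (aX : a \notin X)
  (bX : b \notin X) (book : forall x, x \in X -> [set a; b; x] \in edges F).

Let S : finType := {x : F | x \in X}.

Definition book_coloring (chi : S -> 'I_k) : Prop :=
  exists2 phi : coloring F k, mono_free t phi &
    forall s : S, phi [set a; b; val s] = chi s.

Variable L : linear_system S.

Let port (d : bool + S) : F :=
  match d with inl c => if c then a else b | inr s => val s end.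
Let tgt (e : block L) (d : bool + S) : bool + point L :=
  match d with inl c => inl c | inr s => inr (pt e s) end.
Let V : finType := ((bool + point L) + block L * F)%type.
Let h (e : block L) : F -> V := attach port (tgt e) (fun z => (e, z)).

Let port_inj : injective port.
Proof.
have vX (s : S) : sval s \in X := valP s.
move=> [c|s] [c'|s'] /= E.
- congr inl; case: c c' E ab => [] [] // ->; by rewrite eqxx.
- by case: c E (vX s') => <-; rewrite ?(negPf aX) ?(negPf bX).
- by case: c' E (vX s) => ->; rewrite ?(negPf aX) ?(negPf bX).
- by congr inr; apply: val_inj.
Qed.

Let h_inj e : injective (h e).
Proof.
apply: attach_inj => // [d d'|z z' []] //.
by case: d d' => [c|s] [c'|s'] //= []; [move=> -> | move=> /pt_inj ->].
Qed.

Let G : hypergraph3 := glue (Q := fun=> F) (h := h) h_inj.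

Let h_port e d : h e (port d) = inl (tgt e d).
Proof. exact: attach_port. Qed.

Let h_page e s : h e @: [set a; b; val s] =
  [set inl (inl true); inl (inl false); inl (inr (pt e s))] :> {set V}.
Proof.
rewrite !imsetU !imset_set1.
by rewrite -[a]/(port (inl true)) -[b]/(port (inl false))
  -[val s]/(port (inr s)) !h_port.
Qed.

(** Two copies have in common the spine and, by linearity, at most one page; a triple in both must
    consist of these. *)
Let shared_edge e e' (Y : {set F}) : e != e' -> Y \in edges F ->
  {subset h e' @: Y <= codom (h e)} ->
  exists s s', Y = [set a; b; val s] /\ pt e' s = pt e s'.
Proof.
move=> ee' YF sub.
have PY z : z \in Y -> (z = a \/ z = b) \/ exists s s', z = val s /\ pt e' s = pt e s'.
  move=> zY; have /codomP[w E] := sub _ (imset_f (h e') zY).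
  case E': (h e' z) E => [u|r] /esym E; last first.
    have [Er _] := attach_inr E; have [Er' _] := attach_inr E'.
    by move: Er'; rewrite -Er => -[E'']; rewrite E'' eqxx in ee'.
  have [d [-> ud]] := attach_inl E'; have [d' [_ ud']] := attach_inl E.
  case: d ud => [[]|s] ud; [by left; left|by left; right|right].
  by case: d' ud' => [c|s'] /=; rewrite ud // => -[E'']; exists s, s'.
have c3 := card_edges YF.
have [z zY [za zb]] : exists2 z, z \in Y & z != a /\ z != b.
  have : ~~ (Y \subset [set a; b]).
    apply: contraTN isT => /subset_leq_card; rewrite c3 cards2.
    by case: (a != b).
  by case/subsetPn => z zY; rewrite !inE negb_or => /andP[]; exists z.
have [[E|E]|[s [s' [Es Ess']]]] := PY z zY; rewrite ?E ?eqxx // in za zb.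
exists s, s'; split=> //; apply/eqP; rewrite eqEcard.
have -> /= : Y \subset [set a; b; val s].
  apply/subsetP => y yY; rewrite !inE.
  have [[->|->]|[u [u' [Eu Euu']]]] := PY y yY; rewrite ?eqxx ?orbT //.
  have [us|us] := eqVneq u s; first by rewrite Eu us eqxx !orbT.
  by move: ee'; rewrite (pt_linear us Euu' Ess') eqxx.
rewrite c3 card_set3 //; first by rewrite eq_sym -Es.
by rewrite eq_sym -Es.
Qed.

Let induced_copy e : induced_piece (Q := fun=> F) h e.
Proof.
move=> e' Y YF sub; have [ee'|ee'] := eqVneq e e'; first by exists Y; rewrite ?ee'.
have [s [s' [-> E]]] := shared_edge ee' YF sub.
exists [set a; b; val s']; first by apply: book; apply: valP.
by rewrite !h_page E.
Qed.

Let clique_in_copy (f : 'I_t -> G) : clique f -> exists e, forall l, f l \in codom (h e).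
Proof.
move=> cf; have t2 : 1 < t by apply: leq_trans t4.
(* A vertex that is neither on the spine nor a page determines its copy. *)
have [/existsP[i fi]|/existsPn no] := boolP [exists i, if f i is inr _ then true else false].
  have [j ij] : exists j, i != j.
    have : 0 < #|[set~ i]| by rewrite cardsC1 card_ord -subn1 subn_gt0.
    by case/card_gt0P => j; rewrite !inE eq_sym; exists j.
  apply: (clique_in_piece (i := i) (j := j)) => //; first exact: ltnW.
  move=> p q + _ + _.
  case: (f i) fi => // r _ /codomP[x /esym/attach_inr[Ex _]] /codomP[y /esym/attach_inr[Ey _]].
  by move: Ey; rewrite -Ex => -[->].
(* Otherwise at most two of the [t >= 4] vertices lie on the spine, and two pages determine a block
   by linearity. *)
have [injf _] := cf.
pose J := [set i | if f i is inl (inl _) then true else false].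
have J2 : #|J| <= 2.
  pose g i := if f i is inl (inl c) then c else true.
  have <- : #|g @: J| = #|J|.
    apply: card_in_imset => i j; rewrite !inE /g => + + E.
    case fi: (f i) E => [[c|//]|//]; case fj: (f j) => [[c'|//]|//] E _ _.
    by apply: injf; rewrite fi fj E.
  by rewrite -card_bool max_card.
have /card_gt1P[i [j [iJ jJ ij]]] : 1 < #|~: J|.
  by rewrite cardsCs setCK card_ord ltn_subRL; apply: leq_trans t4; rewrite addn1 ltnS.
apply: (clique_in_piece (i := i) (j := j)) => //; first exact: ltnW.
have pageE l : l \in ~: J -> exists y, f l = inl (inr y).
  by rewrite !inE; case: (f l) (no l) => [[c|y]|r] // _ _; exists y.
have [y Ey] := pageE i iJ; have [z Ez] := pageE j jJ.
have yz : y != z by apply: contraNneq ij => yz; apply/eqP/injf; rewrite Ey Ez yz.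
have codomE e w : (inl (inr w) : V) \in codom (h e) -> exists s, w = pt e s.
  case/codomP => x /esym/attach_inl[[c|s] [_ //= [->]]]; by exists s.
move=> p q; rewrite Ey Ez => /codomE[s Es] /codomE[u Eu] /codomE[s' Es'] /codomE[u' Eu'].
apply: (pt_linear (s := s) (s' := s') (u := u) (u' := u')); rewrite -?Es -?Eu //.
by apply: contraNneq yz => su; rewrite Es Eu su.
Qed.

(** The copies of [F] impose [book_coloring] block by block and nothing more. Pages on no block lie
    in no edge, hence the restriction to covered points. *)
Lemma book_system_realized : exists (G : hypergraph3) (sp : bool -> G)
  (pg : point L -> G),
  [/\ injective sp, injective pg, forall c y, sp c != pg y,
      forall y, covered y -> [set sp true; sp false; pg y] \in edges G &
      (forall phi : coloring G k, mono_free t phi ->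
         solution book_coloring (fun y => phi [set sp true; sp false; pg y])) /\
      (forall chi, solution book_coloring chi -> exists2 phi : coloring G k,
         mono_free t phi &
         forall y, covered y -> phi [set sp true; sp false; pg y] = chi y)].
Proof.
exists G, (fun c => inl (inl c)), (fun y => inl (inr y)); split=> //.
- by move=> c c' [].
- by move=> y z [].
- move=> y [e [s <-]]; rewrite -h_page; apply: (glue_edge (Q := fun=> F) (h := h)).
  by apply: book; apply: valP.
split.
  move=> phi /(mono_free_piece (Q := fun=> F)) free e.
  by eexists; first exact: (free e); move=> s /=; rewrite h_page.
move=> chi sol.
have /fin_all_exists[Phi HPhi] : forall e, exists phi : {ffun {set F} -> 'I_k},
    mono_free t (phi : coloring F k) /\
    forall s : S, phi [set a; b; val s] = chi (pt e s).
  move=> e; have [phi free Ephi] := sol e; exists (finfun phi); split.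
    by apply: mono_free_ext free => Y _; rewrite ffunE.
  by move=> s; rewrite ffunE Ephi.
(* An edge lying in several copies is a page edge, which all of them colour by [chi]; hence any copy
   containing it may be used. *)
pose psi (Z : {set V}) : 'I_k :=
  if [pick e | Z \in [set h e @: (Y : {set F}) | Y in edges F]] is Some e
  then Phi e (h e @^-1: Z) else k0.
have psiE e (Y : {set F}) : Y \in edges F -> psi (h e @: Y) = Phi e Y.
  move=> YF; rewrite /psi; case: pickP => [e' /imsetP[Y' Y'F E]|/(_ e)]; last first.
    by rewrite imset_f.
  have preK e1 (Y1 : {set F}) : h e1 @^-1: (h e1 @: Y1) = Y1.
    by apply/setP => x; rewrite inE mem_imset.
  have [ee'|ee'] := eqVneq e e'; first by rewrite -ee' preK.
  rewrite E preK.
  have sub : {subset h e @: Y <= codom (h e')}.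
    by rewrite E => _ /imsetP[x _ ->]; apply: codom_f.
  have sub' : {subset h e' @: Y' <= codom (h e)}.
    by rewrite -E => _ /imsetP[x _ ->]; apply: codom_f.
  have [s' [u' [EY' _]]] := shared_edge ee' Y'F sub'.
  rewrite eq_sym in ee'; have [s [u [EY _]]] := shared_edge ee' YF sub.
  have : (inl (inr (pt e s)) : V) \in h e @: Y by rewrite EY h_page !inE eqxx !orbT.
  rewrite E EY' h_page !inE /= => /eqP[Ess'].
  have [[_ HY] [_ HY']] := (HPhi e, HPhi e').
  by rewrite EY HY HY' Ess'.
exists psi.
  apply: (mono_free_glue (Q := fun=> F) (h := h)).
    move=> e; have [+ _] := HPhi e; apply: mono_free_ext => Y YF.
    by rewrite psiE.
  by move=> f /clique_in_copy[e fe]; exists e => //; apply: induced_copy.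
move=> y [e [s <-]]; rewrite -h_page psiE; last by apply: book; apply: valP.
by have [_ ->] := HPhi e.
Qed.
End BookSystem.

(** * Senders *)

Definition triple (T : Type) (x y z : T) (i : 'I_3) : T :=
  match val i with 0 => x | 1 => y | _ => z end.

Lemma tripleE (T : finType) (x y z : T) :
  triple x y z @: setT = [set x; y; z].
Proof.
apply/setP => u; rewrite !inE; apply/imsetP/idP.
  by case=> -[[|[|[|//]]] lti] _ ->; rewrite /triple /= eqxx ?orbT.
case/orP=> [/orP[]|] /eqP->.
- by exists (Ordinal (isT : 0 < 3)).
- by exists (Ordinal (isT : 1 < 3)).
- by exists (Ordinal (isT : 2 < 3)).
Qed.

Lemma triple_inj (T : eqType) (x y z : T) :
  x != y -> x != z -> y != z -> injective (triple x y z).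
Proof.
move=> xy xz yz [[|[|[|//]]] i3] [[|[|[|//]]] j3]; rewrite /triple /= => E;
  try (by apply: val_inj); by rewrite E eqxx in xy xz yz.
Qed.

Lemma card_ord3_image (T : finType) (e : 'I_3 -> T) :
  injective e -> #|e @: setT| = 3.
Proof. by move=> inje; rewrite card_imset // cardsT card_ord. Qed.

Lemma edge_eq (G : hypergraph3) (X : {set G}) (e : 'I_3 -> G) :
  injective e -> X \in edges G -> {subset X <= codom e} -> X = e @: setT.
Proof.
move=> inje XG sub; apply/eqP; rewrite eqEcard card_ord3_image //.
rewrite (card_edges XG) leqnn andbT; apply/subsetP => x /sub /codomP[i ->].
exact: imset_f.
Qed.

Section Senders.
Variables k t : nat.

(** Edges are given as ordered triples, so that glueing along them prescribes which vertices are
    identified. *)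
Definition sender (G : hypergraph3) (e f : 'I_3 -> G) : Prop :=
  [/\ injective e /\ injective f,
      e @: setT \in edges G, f @: setT \in edges G,
      exists phi : coloring G k, mono_free t phi &
      forall phi : coloring G k, mono_free t phi ->
        phi (e @: setT) = phi (f @: setT)].

(** Shifts add up under composition, and no two indices in ['I_3] differ by 3, so a shift of 3 means
    disjoint edges. *)
Definition shifted (G : hypergraph3) (d : nat) (e f : 'I_3 -> G) : Prop :=
  forall i j : 'I_3, e i = f j -> i = j + d :> nat.

Definition far (G : hypergraph3) (e f : 'I_3 -> G) : Prop :=
  forall (X : {set G}) i j, X \in edges G -> e i \in X -> f j \notin X.

Lemma realizable_relation : 2 <= k -> 4 <= t ->
  exists (S : finType) (A : (S -> 'I_k) -> Prop),
  [/\ forall chi chi', chi =1 chi' -> A chi -> A chi', exists chi, A chi,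
      forall (s : {perm 'I_k}) chi, A chi -> A (s \o chi),
      forall chi i, A chi -> ~ forall s, chi s = i &
      forall L : linear_system S, exists (G : hypergraph3) (sp : bool -> G)
        (pg : point L -> G),
      [/\ injective sp, injective pg, forall c y, sp c != pg y,
          forall y, covered y -> [set sp true; sp false; pg y] \in edges G &
          (forall phi : coloring G k, mono_free t phi ->
             solution A (fun y => phi [set sp true; sp false; pg y])) /\
          (forall chi, solution A chi -> exists2 phi : coloring G k,
             mono_free t phi &
             forall y, covered y -> phi [set sp true; sp false; pg y] = chi y)]].
Proof.
move=> k2 t4.
have [F [a [b [X [[ab aX bX] book [phi0 free0] nonconst]]]]] := critical_book k2 t4.
exists {x : F | x \in X}, (@book_coloring k t F a b X); split.
- by move=> chi chi' E [phi free Ephi]; exists phi => // s; rewrite -E.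
- by exists (fun s => phi0 [set a; b; val s]), phi0.
- move=> s chi [phi free Ephi]; exists (fun e => s (phi e)).
    exact: mono_free_perm.
  by move=> u; rewrite Ephi.
- move=> chi i [phi free Ephi] cst; apply: (nonconst phi i free) => x xX.
  by rewrite -(cst (Sub x xX)) -Ephi.
exact: (book_system_realized t4 (Ordinal (ltnW k2)) ab aX bX book).
Qed.

Lemma shifted_sender : 2 <= k -> 4 <= t ->
  exists (G : hypergraph3) (e f : 'I_3 -> G), sender e f /\ shifted 1 e f.
Proof.
move=> k2 t4.
have [S [A [A_ext A_ex A_perm A_nonconst realize]]] := realizable_relation k2 t4.
have [L [v [v' [[sep cov cov'] [chi sol] eqv]]]] :=
  equal_pair k2 A_ext A_ex A_perm A_nonconst.
have [G [sp [pg [sp_inj pg_inj sp_pg edge [restr ext]]]]] := realize L.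
have vv' : pg v != pg v' by rewrite (inj_eq pg_inj) separated_neq.
have pg_sp y c : pg y != sp c by rewrite eq_sym.
have sp2 : sp true != sp false by rewrite (inj_eq sp_inj).
(* The two edges share exactly the spine, whose vertices have positions 1 and 2 in the first
   ordering but 0 and 1 in the second. *)
exists G, (triple (pg v) (sp true) (sp false)),
  (triple (sp true) (sp false) (pg v')).
have Ee : triple (pg v) (sp true) (sp false) @: setT =
    [set sp true; sp false; pg v] by rewrite tripleE -setUA setUC.
split.
  split; rewrite ?Ee ?tripleE ?edge //.
  - by split; apply: triple_inj.
  - by have [phi free _] := ext _ sol; exists phi.
  - by move=> phi /restr/eqv.
move=> [[|[|[|//]]] i3] [[|[|[|//]]] j3]; rewrite /triple //= => /eqP;
  by rewrite ?(negPf vv') ?(negPf (sp_pg _ _)) ?(negPf (pg_sp _ _))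
    ?[sp false == _]eq_sym ?(negPf sp2).
Qed.

Lemma rainbow_edges : 2 <= k -> 4 <= t ->
  exists (G : hypergraph3) (e : 'I_k -> 'I_3 -> G),
  [/\ forall i, injective (e i), forall i, e i @: setT \in edges G,
      exists2 phi : coloring G k, mono_free t phi & forall i, phi (e i @: setT) = i &
      forall phi : coloring G k, mono_free t phi ->
        injective (fun i => phi (e i @: setT))].
Proof.
move=> k2 t4.
have [S [A [A_ext A_ex A_perm A_nonconst realize]]] := realizable_relation k2 t4.
have [L [v [sep cov [chi sol] rainbow]]] :=
  rainbow_points k2 A_ext A_ex A_perm A_nonconst.
have [G [sp [pg [sp_inj pg_inj sp_pg edge [restr ext]]]]] := realize L.
exists G, (fun i => triple (sp true) (sp false) (pg (v i))); split.
- by move=> i; apply: triple_inj; rewrite ?(inj_eq sp_inj).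
- by move=> i; rewrite tripleE edge.
(* A good colouring permutes the colours along the rainbow edges; undoing that permutation gives the
   [i]-th edge colour [i]. *)
- have [phi free Ephi] := ext _ sol; pose s := perm (rainbow _ sol).
  exists (fun X => (s^-1)%g (phi X)); first exact: mono_free_perm.
  by move=> i; rewrite tripleE Ephi // -[chi _]/((chi \o v) i) -(permE (rainbow _ sol)) permK.
- move=> phi /restr/rainbow inj i j; rewrite !tripleE; exact: inj.
Qed.

(** * Chaining two senders *)

Section Compose.
Variables (Q1 Q2 : hypergraph3) (e1 f1 : 'I_3 -> Q1) (e2 f2 : 'I_3 -> Q2).
Hypotheses (t4 : 4 <= t) (s1 : sender e1 f1) (s2 : sender e2 f2).

Let V : finType := (Q1 + Q2)%type.
Let Q (b : bool) : hypergraph3 := if b then Q1 else Q2.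
Let h2 : Q2 -> V := attach e2 f1 id.
Let h (b : bool) : Q b -> V :=
  match b return Q b -> V with true => fun x => inl x | false => h2 end.

Let h_inj b : injective (h (b := b)).
Proof.
have [[_ inj1] _ _ _ _] := s1; have [[inj2 _] _ _ _ _] := s2.
by case: b => [x y []|] //; apply: attach_inj.
Qed.

Let G := glue h_inj.

Let h2_port : h2 @: (e2 @: setT) = [set (inl x : V) | x in f1 @: setT].
Proof.
have [[inj2 _] _ _ _ _] := s2.
by rewrite -!imset_comp; apply: eq_imset => i; rewrite /= /h2 attach_port.
Qed.

Let h2_inl (X : {set Q2}) : X \in edges Q2 ->
  {subset h2 @: X <= codom (fun x : Q1 => inl x : V)} -> X = e2 @: setT.
Proof.
have [[inj2 _] _ _ _ _] := s2; move=> XQ sub.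
apply: edge_eq => // x xX.
have /codomP[y /attach_inl[d [-> _]]] := sub _ (imset_f h2 xX).
exact: codom_f.
Qed.

Let induced_half b : induced_piece h b.
Proof.
have [[_ inj1] _ f1Q _ _] := s1; have [_ e2Q _ _ _] := s2.
case: b => [] [] /= X XQ sub.
- by exists X.
- by exists (f1 @: setT) => //; rewrite (h2_inl XQ sub) h2_port.
- exists (e2 @: setT) => //; rewrite h2_port.
  suff -> : X = f1 @: setT by [].
  apply: (@edge_eq Q1 X f1 inj1 XQ) => x xX.
  have /codomP[y /esym/attach_inl[d [_ ->]]] := sub _ (imset_f _ xX).
  exact: codom_f.
- by exists X.
Qed.

(** The halves share only the three vertices of the glued edge, so a fourth vertex of the clique
    determines its half. *)
Let clique_in_half (f : 'I_t -> G) : clique f ->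
  exists b, forall l, f l \in codom (h (b := b)).
Proof.
move=> cf; have [injf _] := cf; have [[_ inj1] _ _ _ _] := s1.
pose U : {set V} := [set inl x | x in f1 @: setT].
have cU : #|U| = 3 by rewrite card_imset ?card_ord3_image // => x y [].
have [l lU] : exists l, f l \notin U.
  apply/existsP; apply: contraTT t4 => /existsPn all_U; rewrite -leqNgt -cU.
  rewrite -[t]card_ord -cardsT -(card_imset _ injf); apply: subset_leq_card.
  by apply/subsetP => _ /imsetP[i _ ->]; have := all_U i; rewrite negbK.
have [j lj] : exists j, l != j.
  have : 0 < #|[set~ l]|.
    by rewrite cardsC1 card_ord -subn1 subn_gt0; apply: leq_trans t4.
  by case/card_gt0P => j; rewrite !inE eq_sym; exists j.
apply: (clique_in_piece (i := l) (j := j)) => //; first exact: ltnW.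
have only : f l \in codom (h (b := true)) -> f l \in codom (h (b := false)) -> False.
  move=> /codomP[x Ex] /codomP[y]; rewrite Ex /= => /esym/attach_inl[d [_ xd]].
  by case/negP: lU; rewrite Ex xd; apply/imset_f/imset_f.
by move=> [] [] // p1 _ p2 _; [case: (only p1 p2)|case: (only p2 p1)].
Qed.

Let e : 'I_3 -> G := fun i => inl (e1 i).
Let f : 'I_3 -> G := fun i => h2 (f2 i).

Let eE : e @: setT = h (b := true) @: (e1 @: setT).
Proof. by rewrite -imset_comp. Qed.

Let fE : f @: setT = h (b := false) @: (f2 @: setT).
Proof. by rewrite -imset_comp. Qed.

Let overlap i j : e i = f j -> exists l, e1 i = f1 l /\ e2 l = f2 j.
Proof. by move=> /esym/attach_inl[l [-> ->]]; exists l. Qed.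

Let sender_compose_aux : sender e f.
Proof.
have [[inj1 inj1'] e1Q f1Q [phi1 free1] eq1] := s1.
have [[inj2 inj2'] e2Q f2Q [phi2 free2] eq2] := s2.
split.
- split; first by move=> i j [/inj1].
  by move=> i j /(h_inj (b := false))/inj2'.
- by rewrite eE; apply: (glue_edge (h := h)).
- by rewrite fE; apply: (glue_edge (h := h)).
(* Colours of the second half are transposed so that both halves agree on the glued edge. *)
- pose s := tperm (phi2 (e2 @: setT)) (phi1 (f1 @: setT)).
  pose psi (Z : {set V}) := if Z \subset codom (fun x : Q1 => inl x : V)
    then phi1 [set x | inl x \in Z] else s (phi2 (h2 @^-1: Z)).
  have pre1 (Y : {set Q1}) : [set x | (inl x : V) \in [set inl x | x in Y]] = Y.
    by apply/setP => x; rewrite inE mem_imset // => y z [].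
  have free1' : mono_free t ((fun X => psi (inl @: X)) : coloring Q1 k).
    apply: mono_free_ext free1 => Y YQ; rewrite /psi pre1 ifT //.
    by apply/subsetP => _ /imsetP[x _ ->]; apply: codom_f.
  have free2' : mono_free t ((fun X => psi (h2 @: X)) : coloring Q2 k).
    apply: mono_free_ext (mono_free_perm (s := s) free2) => Y YQ; rewrite /psi.
    case: ifP => [/subsetP/(h2_inl YQ)->|_]; first by rewrite h2_port pre1 tpermL.
    congr (s (phi2 _)); apply/setP => x; rewrite inE mem_imset //.
    exact: (h_inj (b := false)).
  exists psi; apply: (mono_free_glue (h := h)); first by case.
  by move=> g /clique_in_half[b gb]; exists b.
- move=> phi free; have := eq1 _ (mono_free_piece (i := true) free).
  have := eq2 _ (mono_free_piece (i := false) free).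
  by rewrite /= h2_port eE fE => <- ->.
Qed.

(** A common vertex of the outer edges also lies on the middle edge and passes through both
    overlaps, so shifts add. If both overlaps are empty, an edge inside one half cannot meet both
    outer edges. *)
Lemma sender_compose : exists (G : hypergraph3) (e f : 'I_3 -> G),
  [/\ sender e f,
      forall d1 d2, shifted d1 e1 f1 -> shifted d2 e2 f2 -> shifted (d1 + d2) e f &
      (forall i j, e1 i <> f1 j) -> (forall i j, e2 i <> f2 j) -> far e f].
Proof.
exists G, e, f; split=> //.
  move=> d1 d2 sh1 sh2 i j /overlap[l [/sh1-> /sh2->]].
  by rewrite -addnA [d2 + _]addnC.
move=> dis1 dis2 _ i j /glue_edgesP[b [X [XQ ->]]]; case: b X XQ => X XQ /imsetP[x xX Ex].
  by apply/imsetP => -[y yX /attach_inl[l [/esym/dis2]]].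
by have /esym/attach_inl[l [_ /dis1]] := Ex.
Qed.
End Compose.

(** Three links of shift 1 make the end edges disjoint; joining two such chains leaves no edge
    meeting both ends. *)
Lemma far_sender : 2 <= k -> 4 <= t ->
  exists (G : hypergraph3) (e f : 'I_3 -> G), sender e f /\ far e f.
Proof.
move=> k2 t4; have [G1 [e1 [f1 [s1 sh1]]]] := shifted_sender k2 t4.
have [G2 [e2 [f2 [s2 sh2 _]]]] := sender_compose t4 s1 s1.
have [G3 [e3 [f3 [s3 sh3 _]]]] := sender_compose t4 s2 s1.
have dis i j : e3 i <> f3 j.
  move=> /(sh3 _ _ (sh2 _ _ sh1 sh1) sh1) E.
  by have := ltn_ord i; rewrite E addnC.
have [G4 [e4 [f4 [s4 _ far4]]]] := sender_compose t4 s3 s3.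
by exists G4, e4, f4; split=> //; apply: far4.
Qed.
End Senders.

(** * Codegree zero and orderings of edges *)

Lemma codeg_eq0 (G : hypergraph3) (u v : G) :
  codeg u v = 0 <-> forall X, X \in edges G -> u \in X -> v \notin X.
Proof.
split=> [/eqP|no]; last first.
  apply/eqP; rewrite cards_eq0; apply/eqP/setP => X; rewrite !inE.
  by apply/negP => /and3P[/no uv /uv /negP].
rewrite cards_eq0 => /eqP/setP E X XG uX; apply/negP => vX.
by have := E X; rewrite !inE XG uX vX.
Qed.

Lemma edge_ordering (G : hypergraph3) (X : {set G}) : X \in edges G ->
  exists2 g : {ffun 'I_3 -> G}, injective g & g @: setT = X.
Proof.
move=> XG; have [x [y [z [xy xz yz ->]]]] := card3P (card_edges XG).
exists (finfun (triple x y z)).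
  by move=> i j; rewrite !ffunE; apply: triple_inj.
by rewrite -tripleE; apply: eq_imset => i; rewrite ffunE.
Qed.

(** * Attaching senders to the coloured hypergraph *)

Section AttachSenders.
Variables (k t : nat) (H P S : hypergraph3) (c : coloring H k)
  (pal : 'I_k -> 'I_3 -> P) (se sf : 'I_3 -> S).
Hypotheses (t4 : 4 <= t) (free_c : mono_free t c)
  (pal_inj : forall i, injective (pal i))
  (pal_edge : forall i, pal i @: setT \in edges P)
  (pal_col : exists2 phi : coloring P k, mono_free t phi &
     forall i, phi (pal i @: setT) = i)
  (pal_rainbow : forall phi : coloring P k, mono_free t phi ->
     injective (fun i => phi (pal i @: setT)))
  (sS : sender k t se sf) (farS : far se sf).

Let E := {X : {set H} | X \in edges H}.

Variable ord : E -> 'I_3 -> H.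
Hypotheses (ord_inj : forall X, injective (ord X))
  (ord_im : forall X, ord X @: setT = val X).

Let V : finType := ((H + P) + E * S)%type.
Let I : finType := option (option E).
Let Q (p : I) : hypergraph3 :=
  match p with None => H | Some None => P | Some (Some _) => S end.

Let port (d : 'I_3 + 'I_3) : S :=
  match d with inl i => se i | inr i => sf i end.
(** The sender at [X] joins [X] to the palette edge whose index is the colour of [X]. *)
Let tgt (X : E) (d : 'I_3 + 'I_3) : H + P :=
  match d with inl i => inl (ord X i) | inr i => inr (pal (c (val X)) i) end.
Let hS (X : E) : S -> V := attach port (tgt X) (fun z => (X, z)).
Let h (p : I) : Q p -> V :=
  match p return Q p -> V with
  | None => fun x => inl (inl x)
  | Some None => fun x => inl (inr x)
  | Some (Some X) => hS X
  end.

Let port_inj : injective port.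
Proof.
have [[ie jf] eE _ _ _] := sS.
have no i j : se i <> sf j.
  move=> Eij; have := @farS _ i j eE (imset_f se (in_setT i)).
  by rewrite -Eij imset_f.
move=> [i|i] [j|j] //= Eij.
- by rewrite (ie _ _ Eij).
- by case: (no i j).
- by case: (no j i).
- by rewrite (jf _ _ Eij).
Qed.

Let hS_inj X : injective (hS X).
Proof.
apply: attach_inj => // [|z z' []] //.
move=> [i|i] [j|j] //= [].
  by move/ord_inj->.
by move/pal_inj->.
Qed.

Let h_inj p : injective (h (p := p)).
Proof. by case: p => [[X|]|] /=; [exact: hS_inj|move=> x y []|move=> x y []]. Qed.

Let G := glue h_inj.

Let hS_e X : hS X @: (se @: setT) = [set (inl (inl x) : V) | x in val X].
Proof.
rewrite -[val X]ord_im -!imset_comp; apply: eq_imset => i /=.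
by rewrite -[se i]/(port (inl i)) /hS attach_port.
Qed.

Let hS_f X : hS X @: (sf @: setT) =
  [set (inl (inr x) : V) | x in pal (c (val X)) @: setT].
Proof.
rewrite -!imset_comp; apply: eq_imset => i /=.
by rewrite -[sf i]/(port (inr i)) /hS attach_port.
Qed.

Let hS_inl X x y : hS X x = inl (inl y) -> y \in val X /\ x \in codom se.
Proof.
move/attach_inl => [[i|i] [-> // [->]]]; split; last exact: codom_f.
by rewrite -ord_im imset_f.
Qed.

Let hS_inr X x y : hS X x = inl (inr y) ->
  y \in pal (c (val X)) @: setT /\ x \in codom sf.
Proof.
move/attach_inl => [[i|i] [-> // [->]]]; split; last exact: codom_f.
exact: imset_f.
Qed.

Let hS_new X x r : hS X x = inr r -> (X, x) = r.
Proof. by move/attach_inr => []. Qed.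

(** An edge without new vertices lies in the union of the two ends of the sender; farness confines
    it to one end, which it then equals. *)
Let hS_edge X (Y : {set S}) : Y \in edges S ->
  [\/ exists2 z, z \in Y & exists x, hS X z = inr (X, x),
      Y = se @: setT | Y = sf @: setT].
Proof.
move=> YS; have [[ie jf] _ _ _ _] := sS.
case: (classic (exists2 z, z \in Y & exists x, hS X z = inr (X, x))) => [?|no].
  by constructor 1.
have sub z : z \in Y -> z \in codom se \/ z \in codom sf.
  move=> zY; case Ez: (hS X z) => [[y|y]|r].
  - by left; case: (hS_inl Ez).
  - by right; case: (hS_inr Ez).
  - by case: no; exists z => //; exists z; rewrite Ez (hS_new Ez).
have [z zY] : exists z, z \in Y by apply/card_gt0P; rewrite (card_edges YS).
case: (sub z zY) => /codomP[i Ei]; [constructor 2|constructor 3].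
  apply: edge_eq => // y yY; case: (sub y yY) => // /codomP[j Ej].
  by have := @farS _ i j YS; rewrite -Ei -Ej zY yY => /(_ isT).
apply: edge_eq => // y yY; case: (sub y yY) => // /codomP[j Ej].
by have := @farS _ j i YS; rewrite -Ei -Ej zY yY => /(_ isT).
Qed.

Let induced_all p : induced_piece h p.
Proof.
have [_ seS sfS _ _] := sS.
move=> q Y YQ sub.
have subx x : x \in Y -> exists y, h (p := q) x = h (p := p) y.
  by move=> xY; apply/codomP; apply: sub; apply: imset_f.
have [x0 x0Y] : exists x, x \in Y by apply/card_gt0P; rewrite (card_edges YQ).
case: q Y YQ sub subx x0 x0Y => [[X|]|] Y YQ sub subx x0 x0Y;
  case: p sub subx => [[X'|]|] sub subx.
- have [[z zY [x Ez]]|EY|EY] := hS_edge X YQ.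
  + have [y] := subx z zY; rewrite /h Ez => /esym/hS_new[EX _].
    by rewrite /= in Y YQ sub subx x0 x0Y zY *; rewrite EX; exists Y.
  + exists (se @: setT) => //; rewrite EY /= !hS_e.
    suff -> : val X = val X' by [].
    apply/eqP; rewrite eqEcard (card_edges (valP X)) (card_edges (valP X')) leqnn andbT.
    apply/subsetP => y; rewrite -ord_im => /imsetP[i _ ->].
    have [|z /=] := subx (se i); first by rewrite EY imset_f.
    by rewrite -[se i]/(port (inl i)) {1}/hS attach_port // => /esym/hS_inl[].
  + exists (sf @: setT) => //; rewrite EY /= !hS_f.
    suff -> : pal (c (val X)) @: setT = pal (c (val X')) @: setT by [].
    apply: edge_eq => // y /imsetP[i _ ->].
    have [|z /=] := subx (sf i); first by rewrite EY imset_f.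
    rewrite -[sf i]/(port (inr i)) {1}/hS attach_port // => /esym/hS_inr[].
    by case/imsetP => j _ -> _; apply: codom_f.
- have [[z zY [x Ez]]|EY|EY] := hS_edge X YQ.
  + by have [y] := subx z zY; rewrite /h Ez.
  + have [|y /=] := subx (se ord0); first by rewrite EY imset_f.
    by rewrite -[se _]/(port (inl ord0)) /hS attach_port.
  + by exists (pal (c (val X)) @: setT) => //; rewrite EY /= hS_f.
- have [[z zY [x Ez]]|EY|EY] := hS_edge X YQ.
  + by have [y] := subx z zY; rewrite /h Ez.
  + by exists (val X); [exact: (valP X)|rewrite EY /= hS_e].
  + have [|y /=] := subx (sf ord0); first by rewrite EY imset_f.
    by rewrite -[sf _]/(port (inr ord0)) /hS attach_port.
- exists (sf @: setT) => //; rewrite /= hS_f.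
  suff -> : Y = pal (c (val X')) @: setT by [].
  apply: (@edge_eq P Y _ (@pal_inj _) YQ) => x xY.
  have [y /= /esym/hS_inr[]] := subx x xY.
  by case/imsetP => j _ -> _; apply: codom_f.
- by exists Y.
- by have [y] := subx x0 x0Y.
- exists (se @: setT) => //; rewrite /= hS_e.
  suff -> : Y = val X' by [].
  apply/eqP; rewrite eqEcard (card_edges (valP X')) (@card_edges H _ YQ) andbT.
  by apply/subsetP => x xY; have [y /= /esym/hS_inl[]] := subx x xY.
- by have [y] := subx x0 x0Y.
- by exists Y.
Qed.

Let clique_in_part (f : 'I_t -> G) : clique f ->
  exists p, forall l, f l \in codom (h (p := p)).
Proof.
move=> cf; have [injf edgef] := cf.
have t3 : 3 <= t by apply: ltnW.
have other i : exists j : 'I_t, i != j.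
  have : 0 < #|[set~ i]|.
    by rewrite cardsC1 card_ord -subn1 subn_gt0; apply: leq_trans t4.
  by case/card_gt0P => j; rewrite !inE eq_sym; exists j.
case: (classic (exists i r, f i = inr r)) => [[i [r fi]]|no].
  have [j ij] := other i; apply: (clique_in_piece (i := i) (j := j)) => //.
  have own p : f i \in codom (h (p := p)) -> p = Some (Some r.1).
    by rewrite fi => /codomP[]; case: p => [[X|]|] //= x /esym/hS_new <-.
  by move=> p q /own -> _ /own -> _.
(* Vertices of [H] and [P] in one clique would lie on a common edge, necessarily of a sender, where
   farness forbids it. *)
have apart i j x y : f i = inl (inl x) -> f j = inl (inr y) -> False.
  move=> fi fj; have ij : i != j by apply/eqP => ij; rewrite ij fj in fi.
  have /card_gt0P[l] : 0 < #|~: [set i; j]|.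
    by rewrite cardsCs setCK card_ord cards2 ij subn_gt0.
  rewrite !inE negb_or => /andP[li lj].
  have c3 : #|[set i; j; l]| = 3 by rewrite card_set3 // eq_sym.
  have /glue_edgesP[p [Y [YQ EY]]] := edgef _ c3.
  have : f i \in f @: [set i; j; l] by rewrite imset_f // !inE eqxx.
  have : f j \in f @: [set i; j; l] by rewrite imset_f // !inE eqxx orbT.
  rewrite EY fi fj => /imsetP[y' y'Y Ey] /imsetP[x' x'Y Ex].
  case: p Y YQ EY y' y'Y Ey x' x'Y Ex => [[X|]|] //= Y YQ EY y' y'Y Ey x' x'Y Ex.
  have [_ /codomP[b Eb]] := hS_inr (esym Ey).
  have [_ /codomP[a Ea]] := hS_inl (esym Ex).
  by have := @farS _ a b YQ; rewrite -Ea -Eb x'Y y'Y => /(_ isT).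
case: (classic (exists i x, f i = inl (inl x))) => [[i [x fi]]|noH].
  exists None => l; case fl: (f l) => [[y|y]|r].
  - exact: (codom_f (h (p := None))).
  - by case: (apart _ _ _ _ fi fl).
  - by case: no; exists l, r.
exists (Some None) => l; case fl: (f l) => [[y|y]|r].
- by case: noH; exists l, y.
- exact: (codom_f (h (p := Some None))).
- by case: no; exists l, r.
Qed.

Let colorable_G : exists phi : coloring G k, mono_free t phi.
Proof.
have [_ _ _ [phiS freeS] eqS] := sS; have [phiP freeP palE] := pal_col.
(* A transposition gives both ends of the sender at [X] the colour [c (val X)], as [c] and the
   palette colouring prescribe. *)
pose phi_ (X : E) (Y : {set S}) :=
  tperm (phiS (se @: setT)) (c (val X)) (phiS Y).
have phi_e X : phi_ X (se @: setT) = c (val X) by rewrite /phi_ tpermL.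
have phi_f X : phi_ X (sf @: setT) = c (val X) by rewrite /phi_ -(eqS _ freeS) tpermL.
pose new (z : V) : option E := if z is inr r then Some r.1 else None.
pose inH (z : V) := if z is inl (inl _) then true else false.
pose psi (Z : {set V}) : 'I_k :=
  if [pick z in Z | new z != None] is Some z then
    if new z is Some X then phi_ X (hS X @^-1: Z) else c [set x | inl (inl x) \in Z]
  else if [exists z in Z, inH z] then c [set x | inl (inl x) \in Z]
  else phiP [set x | inl (inr x) \in Z].
have psiH (Y : {set H}) : Y \in edges H -> psi [set inl (inl x) | x in Y] = c Y.
  move=> YH; rewrite /psi; case: pickP => [z /andP[/imsetP[x _ ->]] //|_].
  rewrite ifT.
    by congr c; apply/setP => x; rewrite inE mem_imset // => y z [].
  have /card_gt0P[x xY] : 0 < #|Y| by rewrite (card_edges YH).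
  by apply/existsP; exists (inl (inl x)); rewrite imset_f.
have psiP (Y : {set P}) : psi [set inl (inr x) | x in Y] = phiP Y.
  rewrite /psi; case: pickP => [z /andP[/imsetP[x _ ->]] //|_].
  rewrite ifF.
    by congr phiP; apply/setP => x; rewrite inE mem_imset // => y z [].
  by apply/existsP => -[z /andP[/imsetP[x _ ->]]].
have psiS X (Y : {set S}) : Y \in edges S -> psi (hS X @: Y) = phi_ X Y.
  move=> YS; have [[z zY [x Ez]]|->|->] := hS_edge X YS.
  - rewrite /psi; case: pickP => [z' /andP[/imsetP[y yY ->]]|/(_ (hS X z))]; last first.
      by rewrite imset_f // Ez.
    case Ey: (hS X y) => [u|r] //= _.
    have <- := hS_new Ey; rewrite /=; congr phi_.
    by apply/setP => w; rewrite inE mem_imset //; apply: hS_inj.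
  - by rewrite hS_e psiH ?phi_e //; apply: (valP X).
  - by rewrite hS_f psiP palE phi_f.
have fH : mono_free t ((fun Y => psi [set inl (inl x) | x in Y]) : coloring H k).
  by apply: mono_free_ext free_c => Y /psiH ->.
have fP : mono_free t ((fun Y => psi [set inl (inr x) | x in Y]) : coloring P k).
  by apply: mono_free_ext freeP => Y _; rewrite psiP.
have fS X : mono_free t ((fun Y => psi (hS X @: Y)) : coloring S k).
  apply: (mono_free_ext (c := phi_ X)) => [Y YS|]; first by rewrite psiS.
  exact: mono_free_perm.
exists psi; apply: (mono_free_glue (h := h)).
  by case=> [[X|]|]; [exact: fS|exact: fP|exact: fH].
by move=> f /clique_in_part[p fp]; exists p.
Qed.

(** Behind both codegree claims: by farness, an edge through a vertex of [H] never reaches the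
    palette, and all its new vertices belong to one sender, at an edge containing that vertex. *)
Let edge_meets_H (Z : {set V}) (y : H) : Z \in edges G -> inl (inl y) \in Z ->
  (exists2 Y : {set H}, Y \in edges H & Z = [set inl (inl x) | x in Y]) \/
  exists X : E, [/\ y \in val X, forall x, inl (inl x) \in Z -> x \in val X,
    forall x, inl (inr x) \notin Z & forall r, inr r \in Z -> r.1 = X].
Proof.
move=> /glue_edgesP[[[X|]|] /= [Y [YQ ->]]] /imsetP[x xY Ex] //; last first.
  by left; exists Y.
right; exists X; have [yX /codomP[i Ei]] := hS_inl (esym Ex); split=> //.
- by move=> z /imsetP[w wY /esym/hS_inl[]].
- move=> z; apply/imsetP => -[w wY /esym/hS_inr[_ /codomP[j Ej]]].
  by have := @farS _ i j YQ; rewrite -Ei -Ej xY wY => /(_ isT).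
- by move=> r /imsetP[w wY /esym/hS_new <-].
Qed.

Lemma attach_senders : exists (G : hypergraph3) (f : H -> G),
    [/\ exists phi : coloring G k, mono_free t phi,
        induced_embedding f,
        forall phi : coloring G k, mono_free t phi ->
          exists s : {perm 'I_k},
            forall e : {set H}, e \in edges H -> phi (f @: e) = s (c e),
        forall a b : H, codeg a b = 0 -> codeg (f a) (f b) = 0
      & 4 <= #|H| ->
          forall x : G, x \notin codom f -> exists y : H, codeg x (f y) = 0].
Proof.
pose f (x : H) : G := inl (inl x).
have f_inj : injective f by move=> x y [].
exists G, f; split=> //.
- split=> // e; apply/idP/idP => [fe|eH]; last exact: (glue_edge (i := None) h_inj).
  have /glue_edgesP[q [Y [YQ EY]]] := fe.
  have [|Y' Y'H EY'] := induced_all (p := None) YQ.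
    by rewrite -EY => _ /imsetP[x _ ->]; apply: (codom_f f).
  by rewrite -EY in EY'; rewrite (imset_inj f_inj EY').
- move=> phi free.
  have inj := pal_rainbow (mono_free_piece (i := Some None) free).
  (* The permutation sends [i] to the colour of the [i]-th palette edge; the sender at [e] carries
     this colour from index [c e] to [e]. *)
  exists (perm inj) => e eH; pose X : E := Sub e eH.
  have [_ _ _ _ eqS] := sS.
  have := eqS _ (mono_free_piece (i := Some (Some X)) free).
  by rewrite /= hS_e hS_f permE.
- move=> a b /codeg_eq0 ab; apply/codeg_eq0 => Z ZG aZ; apply/negP => bZ.
  have [[Y YH EZ]|[X [aX /(_ b bZ) bX _ _]]] := edge_meets_H ZG aZ.
    rewrite EZ !mem_imset // in aZ bZ.
    by have := ab _ YH aZ; rewrite bZ.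
  by have := ab _ (valP X) aX; rewrite bX.
move=> H4 x xf.
have sep y : (forall Z, Z \in edges G -> inl (inl y) \in Z -> x \notin Z) ->
    codeg x (f y) = 0.
  move=> no; apply/codeg_eq0 => Z ZG xZ; apply/negP => yZ.
  by have := no Z ZG yZ; rewrite xZ.
case: x xf sep => [[z|z]|[X z]] xf sep.
- by case/negP: xf; apply: (codom_f f).
- have /card_gt0P[y _] : 0 < #|H| by apply: leq_trans H4.
  exists y; apply: sep => Z ZG yZ.
  have [[Y _ ->]|[X [_ _ noP _]]] := edge_meets_H ZG yZ; last exact: noP.
  by apply/imsetP => -[].
(* A new vertex of the sender at [X] shares edges only with those vertices of [H] that lie in [X];
   four vertices leave one outside. *)
have /card_gt0P[y] : 0 < #|~: val X|.
  by rewrite cardsCs setCK (card_edges (valP X)) subn_gt0.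
rewrite inE => yX; exists y; apply: sep => Z ZG yZ.
have [[Y _ ->]|[X' [yX' _ _ new]]] := edge_meets_H ZG yZ; first by apply/imsetP => -[].
by apply: contra yX => /new /= ->.
Qed.
End AttachSenders.

Theorem theorem2p5 (k t : nat) (hk : 2 <= k) (ht : 4 <= t)
    (H : hypergraph3) (c : coloring H k) (hc : mono_free t c) :
  exists (G : hypergraph3) (f : H -> G),
    [/\ exists phi : coloring G k, mono_free t phi,
        induced_embedding f,
        forall phi : coloring G k, mono_free t phi ->
          exists s : {perm 'I_k},
            forall e : {set H}, e \in edges H -> phi (f @: e) = s (c e),
        forall a b : H, codeg a b = 0 -> codeg (f a) (f b) = 0
      & 4 <= #|H| ->
          forall x : G, x \notin codom f -> exists y : H, codeg x (f y) = 0].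
Proof.
have [S [se [sf [sS farS]]]] := far_sender hk ht.
have [P [pal [pal_inj pal_edge pal_col pal_rainbow]]] := rainbow_edges hk ht.
pose E := {X : {set H} | X \in edges H}.
have /fin_all_exists[ord Hord] : forall X : E, exists g : {ffun 'I_3 -> H},
    injective g /\ g @: setT = val X.
  by move=> X; have [g ginj gim] := edge_ordering (valP X); exists g.
apply: (attach_senders ht hc pal_inj pal_edge pal_col pal_rainbow sS farS
  (ord := fun X => ord X)) => X; by have [] := Hord X.
Qed.
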